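(* For every integer $d\ge 3$ there exists a finite Borel measure $\mu$ on $\mathbb{R}^d$, vanishing on every affine hyperplane, such that no $d$ mutually orthogonal hyperplanes $H_1,\dots,H_d\subset\mathbb{R}^d$ define an orthogonal equipartition of $\mu$.
   Context: Hyperplanes $H_1,\dots,H_d\subset\mathbb{R}^d$ define an orthogonal equipartition of a finite Borel measure $\mu$ on $\mathbb{R}^d$ if they are mutually orthogonal (their normal vectors are pairwise orthogonal) and each of the $2^d$ open regions into which they divide $\mathbb{R}^d$ (the sets $\bigcap_{i=1}^d H_i^{s_i}$, $s_i\in\{+,-\}$, where $H_i^{+},H_i^{-}$ are the two open half-spaces bounded by $H_i$) has $\mu$-measure $\mu(\mathbb{R}^d)/2^d$. *)

(* Defs.v *)
From HB Require Import structures.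
From mathcomp Require Import all_boot all_order all_algebra.
From mathcomp Require Import all_classical all_reals all_analysis.
Set Implicit Arguments. Unset Strict Implicit. Unset Printing Implicit Defensive.
Import Order.TTheory GRing.Theory Num.Theory.
Import numFieldNormedType.Exports.
Local Open Scope classical_set_scope.
Local Open Scope ring_scope.

Definition dotv (R : realType) (d : nat) (u v : 'rV[R]_d) : R :=
  \sum_(i < d) u ord0 i * v ord0 i.

Notation borelRV R d := (g_sigma_algebraType (@open 'rV[R%type]_d)).

Definition hyperplane (R : realType) (d : nat) (a : 'rV[R]_d) (c : R)
  : set (borelRV R d) := [set x | dotv a x = c].
Definition halfspace (R : realType) (d : nat) (a : 'rV[R]_d) (c : R) (s : bool)
  : set (borelRV R d) :=
  [set x | if s then c < dotv a x else dotv a x < c].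

Definition orth_region (R : realType) (d : nat) (a : 'I_d -> 'rV[R]_d)
  (c : 'I_d -> R) (s : 'I_d -> bool) : set (borelRV R d) :=
  \bigcap_(i in [set: 'I_d]) halfspace (a i) (c i) (s i).

Definition orthogonal_equipartition (R : realType) (d : nat)
  (mu : set (borelRV R d) -> \bar R)
  (a : 'I_d -> 'rV[R]_d) (c : 'I_d -> R) : Prop :=
  (forall i, a i != 0) /\
  (forall i j, i != j -> dotv (a i) (a j) = 0) /\
  (forall s : 'I_d -> bool,
     mu (orth_region a c s) = mu setT * ((2 ^+ d)^-1)%:E)%E.

(* Main.v *)
(** The measure is the image of the Lebesgue measure on [[1, 2]] under the
    moment curve [t |-> (t, t^2, ..., t^d)]. The curve meets the hyperplane
    [a.x = c] at the roots of a polynomial of degree at most [d] whose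
    non-constant coefficients are the entries of [a]. If the curve visits all
    [2 ^ d] regions, then these polynomials have together at least
    [2 ^ d - 1] roots at [t >= 1]. A polynomial with [d] positive roots has
    coefficients of alternating signs, so two such polynomials never come from
    orthogonal hyperplanes: at most one hyperplane has [d] roots, the others
    have at most [d - 1], hence [2 ^ d - 1 <= d + (d - 1)^2]. This is false for
    [d >= 4]; for [d = 3] it forces the root counts [3, 2, 2], and the three
    orthogonality relations then contradict that all the roots are at least
    [1]. *)
Require Import Defs.
From HB Require Import structures.
From mathcomp Require Import all_boot all_order all_algebra.
From mathcomp Require Import all_classical all_reals all_analysis.
From mathcomp Require Import measurable_realfun ring lra zify polyrcf.
Set Implicit Arguments.
Unset Strict Implicit.
Unset Printing Implicit Defensive.
Import Order.TTheory GRing.Theory Num.Theory.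
Import numFieldNormedType.Exports.
Local Open Scope classical_set_scope.
Local Open Scope ring_scope.

(** * Coefficients of polynomials with positive roots *)

(** Induction on the roots: the coefficient of (X - r) q in degree k + 1 is that of q in degree k
    minus r times that of q in degree k + 1. Opposite signs in q thus add up instead of
    cancelling. *)
Lemma coef_prod_XsubC_alternate (R : realDomainType) (s : seq R) (k : nat) :
  all (fun r => 0 < r) s -> (k <= size s)%N ->
  0 < (-1) ^+ (size s + k) * (\prod_(r <- s) ('X - r%:P))`_k.
Proof.
elim: s k => [|r s IH] k /=.
  by move=> _; case: k => // _; rewrite big_nil coef1 expr0 mul1r ltr01.
move=> /andP[r0 s0]; rewrite big_cons; set q := \prod_(_ <- _) _.
rewrite mulrBl coefB coefXM coefCM.
case: k => [|k] /= lek.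
  have := IH 0%N s0 isT; rewrite addSn exprS -/q; move: (_ ^+ _) => e h.
  have -> : -1 * e * (0 - r * q`_0) = r * (e * q`_0) by ring.
  exact: mulr_gt0.
have h : 0 < (-1) ^+ (size s + k) * q`_k by apply: IH.
(* Only a weak bound: for k equal to [size s] this coefficient lies beyond the leading one and is
   zero. *)
have h' : 0 <= (-1) ^+ (size s + k.+1) * q`_k.+1.
  case: (ltnP k (size s)) => [lt|ge]; first by apply/ltW/IH.
  by rewrite nth_default ?mulr0 // size_prod_XsubC ltnS.
rewrite addSn !addnS; rewrite addnS exprS in h'; rewrite !exprS.
move: h h'; move: (_ ^+ _) => e h h'.
have -> : -1 * (-1 * e) * (q`_k - r * q`_k.+1)
  = e * q`_k + r * (-1 * e * q`_k.+1) by ring.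
by rewrite ltr_pwDl // mulr_ge0 // ltW.
Qed.

(** * Hyperplanes restricted to the moment curve *)

Definition moment_curve (R : realType) (d : nat) (t : R) : 'rV[R]_d :=
  \row_(k < d) t ^+ k.+1.

(** The factor ['X] moves entry k of [a] to degree k + 1, matching the exponents of the curve. *)
Definition hyperplane_poly (R : realType) (d : nat) (a : 'rV[R]_d) (c : R) :=
  'X * rVpoly a - c%:P.

Section HyperplanePoly.
Variables (R : realType) (d : nat).
Implicit Types (a b : 'rV[R]_d) (c t : R) (s : seq R).

Lemma horner_hyperplane_poly a c t :
  (hyperplane_poly a c).[t] = dotv a (moment_curve d t) - c.
Proof.
rewrite !hornerE horner_poly /dotv mulr_sumr; congr (_ - c).
by apply: eq_bigr => i _; rewrite valK !mxE exprS mulrCA.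
Qed.

Lemma coef_hyperplane_poly a c (k : 'I_d) :
  (hyperplane_poly a c)`_k.+1 = a ord0 k.
Proof. by rewrite coefB coefXM coefC subr0 /= coef_rVpoly_ord. Qed.

Lemma hyperplane_poly_neq0 a c : a != 0 -> hyperplane_poly a c != 0.
Proof.
apply: contra_neq => p0; apply/rowP => k.
by rewrite -(coef_hyperplane_poly a c) p0 coef0 mxE.
Qed.

Lemma size_hyperplane_poly a c : (size (hyperplane_poly a c) <= d.+1)%N.
Proof.
apply/leq_sizeP => j; case: j => // j ltdj.
rewrite coefB coefXM coefC subr0 /= nth_default //.
by apply: leq_trans (size_poly _ _) _.
Qed.

Lemma size_roots_hyperplane_poly a c s : a != 0 -> uniq s ->
  all (root (hyperplane_poly a c)) s -> (size s <= d)%N.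
Proof.
move=> a0 us rs; rewrite -ltnS.
apply: leq_trans (size_hyperplane_poly a c).
by apply: max_poly_roots => //; exact: hyperplane_poly_neq0.
Qed.

(** The d distinct roots force the degree to be exactly d, so the polynomial splits; [l] is its
    leading coefficient. *)
Lemma hyperplane_poly_full_roots a c s : a != 0 -> uniq s -> size s = d ->
  all (root (hyperplane_poly a c)) s ->
  exists2 l : R, l != 0 &
    forall k : 'I_d, a ord0 k = l * (\prod_(r <- s) ('X - r%:P))`_k.+1.
Proof.
move=> a0 us sd rs; have p0 := @hyperplane_poly_neq0 a c a0.
exists (lead_coef (hyperplane_poly a c)); first by rewrite lead_coef_eq0.
move=> k; rewrite -(coef_hyperplane_poly a c) -coefZ.
congr (coefp k.+1 _); apply: all_roots_prod_XsubC; rewrite ?uniq_rootsE //.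
apply/eqP; rewrite sd eqn_leq size_hyperplane_poly /= -{1}sd.
by apply: max_poly_roots.
Qed.

(* Both coefficient sequences alternate in sign, so the products of
   corresponding coefficients all have the same sign. *)
Lemma full_roots_not_orthogonal a b c c' s s' :
  (0 < d)%N -> a != 0 -> b != 0 ->
  uniq s -> size s = d -> all (fun r => 0 < r) s ->
  all (root (hyperplane_poly a c)) s ->
  uniq s' -> size s' = d -> all (fun r => 0 < r) s' ->
  all (root (hyperplane_poly b c')) s' ->
  dotv a b != 0.
Proof.
move=> d0 a0 b0 us sd sp rs us' sd' sp' rs'.
have [l l0 El] := @hyperplane_poly_full_roots a c s a0 us sd rs.
have [m m0 Em] := @hyperplane_poly_full_roots b c' s' b0 us' sd' rs'.
have -> : dotv a b = l * m * \sum_(k < d)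
    (\prod_(r <- s) ('X - r%:P))`_k.+1 * (\prod_(r <- s') ('X - r%:P))`_k.+1.
  rewrite /dotv mulr_sumr; apply: eq_bigr => k _.
  by rewrite El Em mulrACA.
rewrite mulf_neq0 ?mulf_neq0 //.
have P (k : 'I_d) : 0 < (\prod_(r <- s) ('X - r%:P))`_k.+1 *
                        (\prod_(r <- s') ('X - r%:P))`_k.+1.
  have lek : (k.+1 <= d)%N by exact: ltn_ord.
  have h := @coef_prod_XsubC_alternate R s k.+1 sp.
  have h' := @coef_prod_XsubC_alternate R s' k.+1 sp'.
  rewrite sd in h; rewrite sd' in h'.
  have := mulr_gt0 (h lek) (h' lek).
  by rewrite mulrACA -exprD addnn -mul2n exprM sqrrN !expr1n mul1r.
rewrite (bigD1 (Ordinal d0)) //= lt0r_neq0 //.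
apply: ltr_pwDl; first exact: (P (Ordinal d0)).
by apply: sumr_ge0 => k _; exact: ltW.
Qed.

End HyperplanePoly.

(** * Root relations in dimension three *)

Section ThreeDim.
Variable R : realType.
Implicit Types (a : 'rV[R]_3) (c x y z : R).

Let i0 : 'I_3 := inord 0.
Let i1 : 'I_3 := inord 1.
Let i2 : 'I_3 := inord 2.

Lemma dotv3 a b :
  dotv a b =
  a ord0 i0 * b ord0 i0 + a ord0 i1 * b ord0 i1 + a ord0 i2 * b ord0 i2.
Proof.
rewrite /dotv !big_ord_recl big_ord0 addr0 addrA.
by congr (a _ _ * b _ _ + a _ _ * b _ _ + a _ _ * b _ _);
  apply/val_inj; rewrite /= inordK.
Qed.

Lemma row3_eq0 a : a ord0 i0 = 0 -> a ord0 i1 = 0 -> a ord0 i2 = 0 -> a = 0.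
Proof.
move=> h0 h1 h2; apply/rowP => k; rewrite mxE.
by case: k => [[|[|[|//]]] lt]; [rewrite -h0|rewrite -h1|rewrite -h2];
  congr (a _ _); apply/val_inj; rewrite /= inordK.
Qed.

(** A first divided difference: the entries of [a] are the coefficients of t, t^2, t^3; subtract the
    two root equations and divide by x - y. *)
Lemma hyperplane_poly3_two_roots a c x y : x != y ->
  root (hyperplane_poly a c) x -> root (hyperplane_poly a c) y ->
  a ord0 i0 = - (a ord0 i1 * (x + y)) - a ord0 i2 * (x ^+ 2 + x * y + y ^+ 2).
Proof.
move=> xy /rootP; rewrite horner_hyperplane_poly dotv3 !mxE !inordK // => hx.
move=> /rootP; rewrite horner_hyperplane_poly dotv3 !mxE !inordK // => hy.
apply/eqP; rewrite -subr_eq0; apply/eqP.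
apply: (mulfI (x := x - y)); first by rewrite subr_eq0.
by rewrite mulr0; lra.
Qed.

(** Vieta's formulas, obtained by subtracting two instances of the two-root relation and dividing by
    y - z. *)
Lemma hyperplane_poly3_three_roots a c x y z :
  x != y -> x != z -> y != z ->
  root (hyperplane_poly a c) x -> root (hyperplane_poly a c) y ->
  root (hyperplane_poly a c) z ->
  a ord0 i1 = - (a ord0 i2 * (x + y + z)) /\
  a ord0 i0 = a ord0 i2 * (x * y + y * z + z * x).
Proof.
move=> xy xz yz hx hy hz.
have e1 := @hyperplane_poly3_two_roots a c x y xy hx hy.
have e2 := @hyperplane_poly3_two_roots a c x z xz hx hz.
have E : a ord0 i1 = - (a ord0 i2 * (x + y + z)).
  apply/eqP; rewrite -subr_eq0; apply/eqP.
  apply: (mulfI (x := y - z)); first by rewrite subr_eq0.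
  by rewrite mulr0; lra.
by split => //; rewrite e1 E; ring.
Qed.

(* Orthogonality to the plane with normal [(e2, - e1, 1)] determines the
   normals of the other two planes up to scaling; the inner product of these
   is then a sum of positive terms because all the roots are at least [1]. *)
Lemma roots322_not_orthogonal a1 a2 a3 c1 c2 c3 (s1 s2 s3 : seq R) :
  a1 != 0 -> a2 != 0 -> a3 != 0 ->
  [/\ uniq s1, size s1 = 3%N, all (fun r => 1 <= r) s1 &
      all (root (hyperplane_poly a1 c1)) s1] ->
  [/\ uniq s2, size s2 = 2%N, all (fun r => 1 <= r) s2 &
      all (root (hyperplane_poly a2 c2)) s2] ->
  [/\ uniq s3, size s3 = 2%N, all (fun r => 1 <= r) s3 &
      all (root (hyperplane_poly a3 c3)) s3] ->
  dotv a1 a2 = 0 -> dotv a1 a3 = 0 -> dotv a2 a3 <> 0.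
Proof.
move=> n1 n2 n3 [].
case: s1 => [|x [|y [|z [|//]]]] //=.
rewrite !inE andbT negb_or => /andP[/andP[xy xz] yz] _.
move=> /and4P[x1 y1 z1 _] /and4P[rx ry rz _] [].
case: s2 => [|p [|q [|//]]] //=.
rewrite !inE andbT => pq _ /and3P[p1 q1 _] /and3P[rp rq _] [].
case: s3 => [|p' [|q' [|//]]] //=.
rewrite !inE andbT => pq' _ /and3P[p1' q1' _] /and3P[rp' rq' _].
have [E1 E0] := hyperplane_poly3_three_roots xy xz yz rx ry rz.
have F := hyperplane_poly3_two_roots pq rp rq.
have F' := hyperplane_poly3_two_roots pq' rp' rq'.
have w0 : a1 ord0 i2 != 0.
  apply: contraNneq n1 => w; apply/eqP/row3_eq0;
    by rewrite ?E1 ?E0 w ?mul0r ?oppr0.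
rewrite !dotv3 E1 E0.
set w := a1 ord0 i2 in w0 *.
have := ler_pM ler01 ler01 x1 y1; have := ler_pM ler01 ler01 y1 z1.
have := ler_pM ler01 ler01 z1 x1; rewrite mulr1 => g1 g2 g3.
set e2 := x * y + y * z + z * x; set e1 := x + y + z.
have e2g : 1 <= e2 by rewrite /e2; lra.
have e1g : 1 <= e1 by rewrite /e1; lra.
have K (u v : R) : 1 <= u -> 1 <= v -> 1 <= u ^+ 2 + u * v + v ^+ 2.
  move=> hx hy; have := ler_pM ler01 ler01 hx hy.
  have := ler_pM ler01 ler01 hx hx.
  have := ler_pM ler01 ler01 hy hy; rewrite mulr1 !expr2; lra.
have k1 := K _ _ p1 q1; have k1' := K _ _ p1' q1'.
move: F F' k1 k1'.
set k := (_ + _ + q ^+ 2); set k' := (_ + _ + q' ^+ 2).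
have : 1 <= p + q by lra.
have : 1 <= p' + q' by lra.
set m := p + q; set m' := p' + q' => m1' m1 F F' k1 k1' O O' O''.
(* Orthogonality to (e2, - e1, 1), with the first entry of [a2] eliminated by [F]. *)
have {}O : a2 ord0 i1 * (e1 + e2 * m) = a2 ord0 i2 * (1 - e2 * k).
  by apply: (mulfI w0); rewrite F in O; lra.
have {}O' : a3 ord0 i1 * (e1 + e2 * m') = a3 ord0 i2 * (1 - e2 * k').
  by apply: (mulfI w0); rewrite F' in O'; lra.
have A : a2 ord0 i0 * (e1 + e2 * m) = - (a2 ord0 i2 * (m + k * e1)).
  transitivity (- (a2 ord0 i1 * (e1 + e2 * m)) * m
    - a2 ord0 i2 * k * (e1 + e2 * m)).
    by rewrite F; ring.
  by rewrite O; ring.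
have A' : a3 ord0 i0 * (e1 + e2 * m') = - (a3 ord0 i2 * (m' + k' * e1)).
  transitivity (- (a3 ord0 i1 * (e1 + e2 * m')) * m'
    - a3 ord0 i2 * k' * (e1 + e2 * m')).
    by rewrite F'; ring.
  by rewrite O'; ring.
have ge1M (u v : R) : 1 <= u -> 1 <= v -> 1 <= u * v.
  by move=> hu hv; rewrite -[1]mulr1 ler_pM.
have M1 : 1 <= e2 * m by exact: ge1M.
have M1' : 1 <= e2 * m' by exact: ge1M.
have M2 : 1 <= e2 * k by exact: ge1M.
have M2' : 1 <= e2 * k' by exact: ge1M.
have M3 : 1 <= k * e1 by exact: ge1M.
have M3' : 1 <= k' * e1 by exact: ge1M.
(* This is the inner product of (- (m + k e1), 1 - e2 k, e1 + e2 m) with its primed analogue. Both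
   middle entries are nonpositive since e2 k and e2 k' are at least 1. *)
have T : 0 < (m + k * e1) * (m' + k' * e1) + (e2 * k - 1) * (e2 * k' - 1)
  + (e1 + e2 * m) * (e1 + e2 * m').
  apply: ltr_wpDl; last by apply: mulr_gt0; lra.
  by apply: addr_ge0; apply: mulr_ge0; lra.
have Z : a2 ord0 i2 * a3 ord0 i2 = 0.
  apply: (mulfI (lt0r_neq0 T)); rewrite mulr0.
  transitivity (a2 ord0 i0 * (e1 + e2 * m) * (a3 ord0 i0 * (e1 + e2 * m')) +
     a2 ord0 i1 * (e1 + e2 * m) * (a3 ord0 i1 * (e1 + e2 * m')) +
     a2 ord0 i2 * (e1 + e2 * m) * (a3 ord0 i2 * (e1 + e2 * m'))).
    by rewrite O O' A A'; ring.
  transitivity ((e1 + e2 * m) * (e1 + e2 * m') * (a2 ord0 i0 * a3 ord0 i0 +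
     a2 ord0 i1 * a3 ord0 i1 + a2 ord0 i2 * a3 ord0 i2)); first by ring.
  by rewrite O'' mulr0.
(* By the relations just derived, a zero last entry would make the whole normal vanish. *)
have nz (a : 'rV[R]_3) (n l : R) : a != 0 -> 0 < e1 + e2 * n ->
    a ord0 i1 * (e1 + e2 * n) = a ord0 i2 * (1 - e2 * l) ->
    a ord0 i0 * (e1 + e2 * n) = - (a ord0 i2 * (n + l * e1)) ->
    a ord0 i2 != 0.
  move=> na /lt0r_neq0 E1n h1 h0; apply: contraNneq na => h2.
  apply/eqP/row3_eq0 => //; apply: (mulIf E1n).
    by rewrite h0 h2 !mul0r oppr0.
  by rewrite h1 h2 !mul0r.
have := nz a2 m k n2 ltac:(lra) O A.
have := nz a3 m' k' n3 ltac:(lra) O' A'.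
by move/eqP: Z; rewrite mulf_eq0 => /orP[]/eqP ->; rewrite eqxx.
Qed.

End ThreeDim.

(** * Counting roots by sign changes *)

Section SignChanges.
Variable R : realType.

(** The intermediate value theorem puts a root strictly inside each interval with a sign change;
    these open intervals are disjoint, so the roots are distinct. *)
Lemma sign_changes_roots (p : {poly R}) (n : nat) (x : nat -> R) :
  (forall i j, (i < j <= n)%N -> x i < x j) ->
  exists s : seq R,
    [/\ uniq s, size s = (\sum_(j < n) (p.[x j] * p.[x j.+1] < 0)%R)%N,
        all (fun r => x 0%N <= r) s & all (root p) s].
Proof.
move=> xmono.
pose J := [set j : 'I_n | p.[x j] * p.[x j.+1] < 0]%SET.
have /choice[f fP] (j : 'I_n) :
    exists r, j \in J -> (x j < r < x j.+1) /\ root p r.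
  (* The value 0 outside [J] is a dummy: only images of [J] are collected. *)
  have [|] := boolP (j \in J); last by exists 0.
  rewrite inE => /poly_ivtoo[|r]; last by rewrite in_itv /= => ? ?; exists r.
  by apply/ltW/xmono; rewrite ltnSn ltn_ord.
have xle (i j : nat) : (i <= j <= n)%N -> x i <= x j.
  rewrite leq_eqVlt => /andP[/orP[/eqP ->//|lt] le].
  by apply/ltW/xmono; rewrite lt.
exists [seq f j | j <- enum J]; split.
- rewrite map_inj_in_uniq ?enum_uniq // => j k.
  rewrite !mem_enum => jJ kJ Ef.
  have [/andP[j1 j2] _] := fP j jJ; have [/andP[k1 k2] _] := fP k kJ.
  apply/val_inj; case: (ltngtP j k) => // lt.
  + have := xle j.+1 k; rewrite lt ltnW ?ltn_ord // => /(_ isT).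
    by rewrite leNgt (lt_trans k1) // -Ef.
  + have := xle k.+1 j; rewrite lt ltnW ?ltn_ord // => /(_ isT).
    by rewrite leNgt (lt_trans j1) // Ef.
- rewrite size_map -cardE -sum1_card big_mkcond /=.
  by apply: eq_bigr => j _; rewrite inE; case: (_ < 0).
- apply/allP => y /mapP[j]; rewrite mem_enum => /fP[/andP[h _] _] ->.
  by apply: le_trans (ltW h); apply: xle; exact: ltnW (ltn_ord j).
- by apply/allP => y /mapP[j]; rewrite mem_enum => /fP[_ h] ->.
Qed.

(** Sort one parameter per region. Consecutive parameters lie in different regions, so some
    polynomial changes sign between them: each of the 2^d - 1 gaps yields a root. *)
Lemma regions_many_roots (d : nat) (a : 'I_d -> 'rV[R]_d) (c : 'I_d -> R) :
  (forall s, exists2 t, 1 <= t & orth_region a c s (moment_curve d t)) ->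
  exists r : 'I_d -> seq R,
    (forall i, [/\ uniq (r i), all (fun t => 1 <= t) (r i) &
                   all (root (hyperplane_poly (a i) (c i))) (r i)]) /\
    (2 ^ d <= (\sum_i size (r i)).+1)%N.
Proof.
move=> H.
(* Sign vectors become finite functions so that they can be enumerated. *)
have /choice[t tP] (s : {ffun 'I_d -> bool}) : exists t : R, 1 <= t /\
    forall i, if s i then 0 < (hyperplane_poly (a i) (c i)).[t]
              else (hyperplane_poly (a i) (c i)).[t] < 0.
  have [t t1 st] := H s; exists t; split => // i.
  have := st i I; rewrite /halfspace /= horner_hyperplane_poly.
  by case: (s i); rewrite ?subr_gt0 ?subr_lt0.
have tinj : injective t.
  move=> s s' E; apply/ffunP => i.
  have [_ /(_ i)] := tP s; have [_ /(_ i)] := tP s'; rewrite E.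
  by case: (s i); case: (s' i) => // h1 h2;
    have := lt_trans h1 h2; rewrite ltxx.
pose xs := sort <=%R [seq t s | s <- enum {: {ffun 'I_d -> bool}}].
have xsS : size xs = (2 ^ d)%N.
  by rewrite size_sort size_map -cardE card_ffun card_bool card_ord.
have xslt : sorted <%R xs by rewrite sort_lt_sorted map_inj_uniq ?enum_uniq.
have xsE j : (j < 2 ^ d)%N -> exists s, nth 0 xs j = t s.
  rewrite -xsS => /(mem_nth 0); rewrite mem_sort => /mapP[s _ ->].
  by exists s.
pose n := (2 ^ d).-1.
have nE : n.+1 = (2 ^ d)%N by rewrite prednK // expn_gt0.
have mono i j : (i < j <= n)%N -> nth 0 xs i < nth 0 xs j.
  move=> /andP[lt le].
  have ltj : (j < size xs)%N by rewrite xsS -nE.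
  by rewrite (lt_sorted_ltn_nth 0 xslt) // inE (ltn_trans lt).
have /choice[r rP] i :=
  @sign_changes_roots (hyperplane_poly (a i) (c i)) n _ mono.
exists r; split.
  move=> i; have [u _ g rt] := rP i; split => //.
  apply: sub_all g => y; apply: le_trans.
  by have [s ->] := xsE 0%N ltac:(by rewrite expn_gt0); have [] := tP s.
rewrite -nE ltnS (eq_bigr (fun i => \sum_(j < n)
    ((hyperplane_poly (a i) (c i)).[nth 0 xs j] *
     (hyperplane_poly (a i) (c i)).[nth 0 xs j.+1] < 0)%R)%N); last first.
  by move=> i _; have [_ -> _ _] := rP i.
(* Count per gap instead of per hyperplane: each gap must contribute at least 1. *)
rewrite exchange_big /= -[X in (X <= _)%N](card_ord n) -sum1_card.
apply: leq_sum => j _.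
have [s Es] := xsE j ltac:(by rewrite -nE ltnS ltnW).
have [s' Es'] := xsE j.+1 ltac:(by rewrite -nE ltnS).
have lt : t s < t s' by rewrite -Es -Es'; apply: mono; rewrite ltnSn ltn_ord.
have [i ni] : exists i, s i != s' i.
  apply/existsP; apply: contraTT lt; rewrite negb_exists => /forallP e.
  suff -> : s = s' by rewrite ltxx.
  by apply/ffunP => i; have := e i; rewrite negbK => /eqP.
rewrite (bigD1 i) //= Es Es' (_ : _ * _ < 0) //.
have [_ /(_ i)] := tP s; have [_ /(_ i)] := tP s'; move: ni.
by case: (s i); case: (s' i) => // _ h1 h2;
  [rewrite pmulr_rlt0|rewrite nmulr_rlt0].
Qed.

End SignChanges.

(** * Contradiction between root counts *)

(** At d = 3 both sides equal 7, which is why dimension three is treated separately. *)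
Lemma quadratic_lt_expn2 d : (4 <= d)%N -> (d + d.-1 * d.-1 < (2 ^ d).-1)%N.
Proof.
elim: d => // d IH; rewrite leq_eqVlt => /predU1P[<-//|]; rewrite ltnS => d4.
by have := IH d4; rewrite expnS /=; move: (2 ^ d)%N => N; nia.
Qed.

Lemma orthogonal_regions_not_all_met (R : realType) (d : nat)
    (a : 'I_d -> 'rV[R]_d) (c : 'I_d -> R) : (3 <= d)%N ->
  (forall i, a i != 0) -> (forall i j, i != j -> dotv (a i) (a j) = 0) ->
  ~ (forall s, exists2 t, 1 <= t & orth_region a c s (moment_curve d t)).
Proof.
move=> d3 a0 orth /regions_many_roots[r [rP]].
have led i : (size (r i) <= d)%N.
  by have [u _ h] := rP i; apply: size_roots_hyperplane_poly h.
have full i j : i != j -> size (r i) = d -> size (r j) = d -> False.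
  move=> ij si sj; have [ui gi hi] := rP i; have [uj gj hj] := rP j.
  have pos : subpred (fun t : R => 1 <= t) (fun t => 0 < t).
    by move=> t; apply: lt_le_trans.
  have := @full_roots_not_orthogonal _ _ (a i) (a j) (c i) (c j) (r i) (r j).
  rewrite orth // eqxx => F; suff : false by [].
  by apply: F => //; [exact: ltn_trans d3|exact: sub_all gi|exact: sub_all gj].
move: d3; rewrite leq_eqVlt => /predU1P[d3|d4].
  subst d.
  pose o (k : nat) : 'I_3 := inord k.
  have oE k l : (k < 3)%N -> (l < 3)%N -> k != l -> o k != o l.
    by move=> k3 l3; rewrite -val_eqE /= !inordK.
  have n01 : o 0 != o 1 by exact: oE.
  have n02 : o 0 != o 2 by exact: oE.
  have n12 : o 1 != o 2 by exact: oE.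
  have -> : (\sum_i size (r i) =
      size (r (o 0)) + size (r (o 1)) + size (r (o 2)))%N.
    rewrite !big_ord_recl big_ord0 addn0 addnA.
    by congr (size (r _) + size (r _) + size (r _))%N;
      apply/val_inj; rewrite /= inordK.
  have F01 := full _ _ n01; have F02 := full _ _ n02; have F12 := full _ _ n12.
  have l0 := led (o 0); have l1 := led (o 1); have l2 := led (o 2).
  rewrite -[(2 ^ 3)%N]/8%N => sum.
  have fin i j k : i != j -> i != k -> j != k ->
      size (r i) = 3%N -> size (r j) = 2%N -> size (r k) = 2%N -> False.
    move=> ij ik jk si sj sk.
    have [ui gi hi] := rP i; have [uj gj hj] := rP j; have [uk gk hk] := rP k.
    have := @roots322_not_orthogonal _ (a i) (a j) (a k) (c i) (c j) (c k)
      (r i) (r j) (r k) (a0 _) (a0 _) (a0 _) (And4 ui si gi hi)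
      (And4 uj sj gj hj) (And4 uk sk gk hk).
    by rewrite !orth // => /(_ erefl erefl).
  (* A total of at least 7, with counts at most 3 and at most one of them 3, leaves only 3, 2, 2 in
     some order. *)
  have [[]|[[]|[]]] :
    (size (r (o 0)) = 3 /\ size (r (o 1)) = 2 /\ size (r (o 2)) = 2
    \/ size (r (o 1)) = 3 /\ size (r (o 0)) = 2 /\ size (r (o 2)) = 2
    \/ size (r (o 2)) = 3 /\ size (r (o 0)) = 2 /\ size (r (o 1)) = 2)%N.
    move: sum F01 F02 F12 l0 l1 l2.
    by move: (size (r (o 0))) (size (r (o 1))) (size (r (o 2))) => x y z; lia.
  - by move=> s0 [s1 s2]; apply: (fin (o 0) (o 1) (o 2)).
  - by move=> s1 [s0 s2]; apply: (fin (o 1) (o 0) (o 2)); rewrite // eq_sym.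
  - by move=> s2 [s0 s1]; apply: (fin (o 2) (o 0) (o 1)); rewrite // eq_sym.
have d0 : (0 < d)%N by exact: ltn_trans d4.
(* [i0] is the hyperplane with d roots if there is one, and arbitrary otherwise. *)
have [i0 i0P] : exists i0, forall i, i != i0 -> (size (r i) <= d.-1)%N.
  have [/existsP[i0 /eqP s0]|] := boolP [exists i, size (r i) == d].
    exists i0 => i ni; rewrite -ltnS prednK //.
    rewrite ltn_neqAle led andbT; apply/eqP => si.
    exact: (full i i0).
  rewrite negb_exists => /forallP h; exists (Ordinal d0) => i _.
  by rewrite -ltnS prednK // ltn_neqAle led andbT.
apply/negP; rewrite -ltnNge.
suff le : (\sum_i size (r i) <= d + d.-1 * d.-1)%N.
  by have := quadratic_lt_expn2 d4; move: le; lia.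
rewrite (bigD1 i0) //= leq_add //.
apply: leq_trans (leq_sum _ _) _; first exact: i0P.
by rewrite sum_nat_const cardC1 card_ord.
Qed.

(** * Lebesgue measure carried by the moment curve *)

Section MomentMeasure.
Variables (R : realType) (d : nat).

Lemma moment_curve_continuous : continuous (moment_curve d : R -> 'rV[R]_d).
Proof.
move=> t U [P nP sP]; rewrite /=.
have : \forall x \near t, forall k : 'I_d, P ord0 k (x ^+ k.+1).
  apply: (@filter_forall R 'I_d (fun k x => P ord0 k (x ^+ k.+1))
    (nbhs t) _) => k.
  have := @exprn_continuous R k.+1 t (P ord0 k); apply.
  by have := nP ord0 k; rewrite mxE.
apply: filterS => x hx; apply: sP => i k /=.
by rewrite (ord1 i) mxE.
Qed.

Lemma measurable_moment_curve :
  measurable_fun setT (moment_curve d : measurableTypeR R -> borelRV R d).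
Proof.
apply: (@measurability _ _ (measurableTypeR R) (borelRV R d)
  setT _ (@open 'rV[R]_d) erefl).
move=> _ [U oU <-]; rewrite setTI; apply: open_measurable.
by move/continuousP: moment_curve_continuous; apply.
Qed.

Let restriction12 : {measure set (measurableTypeR R) -> \bar R} :=
  mrestr lebesgue_measure (measurable_itv `[1 : R, 2]).

Definition moment_measure : set (borelRV R d) -> \bar R :=
  pushforward restriction12 (moment_curve d : measurableTypeR R -> borelRV R d).

(** The measure structure of a pushforward depends on a measurability proof; it is built here and
    then transferred to [moment_measure]. *)
Let pushforward_measure : {measure set (borelRV R d) -> \bar R} :=
  measure_function_pushforward__canonical__measure_function_Measure
    restriction12 measurable_moment_curve.

HB.instance Definition _ := isMeasure.Build _ _ _ moment_measure
  (measure0 pushforward_measure) (measure_ge0 pushforward_measure)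
  (@measure_semi_sigma_additive _ _ _ pushforward_measure).

Lemma moment_measureE A :
  moment_measure A = lebesgue_measure ((moment_curve d @^-1` A) `&` `[1, 2]).
Proof. by []. Qed.

Lemma moment_measure_setT : moment_measure setT = 1%E.
Proof.
rewrite moment_measureE preimage_setT setTI lebesgue_measure_itv /=.
by rewrite lte_fin ltr1n -EFinB addrK.
Qed.

Lemma moment_measure_fin_num : fin_num_fun moment_measure.
Proof.
move=> A mA; rewrite ge0_fin_numE // (@le_lt_trans _ _ 1%E) ?ltry //.
by rewrite -moment_measure_setT le_measure ?inE.
Qed.

HB.instance Definition _ :=
  Measure_isFinite.Build _ _ _ moment_measure moment_measure_fin_num.

(** The parameters on the hyperplane are roots of a nonzero polynomial of degree at most d, hence a
    finite, null set. *)
Lemma moment_measure_hyperplane (a : 'rV[R]_d) (c : R) :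
  a != 0 -> moment_measure (hyperplane a c) = 0%E.
Proof.
move=> a0; rewrite moment_measureE.
apply: countable_lebesgue_measure0; apply: finite_set_countable.
apply: contrapT => /(@infinite_set_fset _ _ d.+1)[B sB].
apply/negP; rewrite -ltnNge ltnS.
apply: (size_roots_hyperplane_poly (c := c) a0 (finmap.fset_uniq B)).
apply/allP => t tB; have [/= h _] := sB t tB.
by apply/rootP; rewrite horner_hyperplane_poly h subrr.
Qed.

Lemma moment_measure_neq0 (A : set (borelRV R d)) :
  moment_measure A <> 0%E -> exists2 t, 1 <= t & A (moment_curve d t).
Proof.
move=> A0; have [t []] : (moment_curve d @^-1` A) `&` `[1, 2] !=set0.
  apply/set0P; apply: contra_notN A0 => /eqP A0.
  by rewrite moment_measureE A0 measure0.
by rewrite /= in_itv /= => At /andP[t1 _]; exists t.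
Qed.

End MomentMeasure.

Theorem theorem1 (R : realType) (d : nat) : (3 <= d)%N ->
  exists mu : {finite_measure set (borelRV R d) -> \bar R},
    (forall (a : 'rV[R]_d) (c : R), a != 0 -> mu (hyperplane a c) = 0%E) /\
    (forall (a : 'I_d -> 'rV[R]_d) (c : 'I_d -> R),
       ~ orthogonal_equipartition mu a c).
Proof.
move=> d3; exists (@moment_measure R d); split.
  by move=> a c; exact: moment_measure_hyperplane.
move=> a c [a0 [orth equi]].
apply: (orthogonal_regions_not_all_met (a := a) (c := c) d3 a0 orth) => s.
(* In an equipartition every region has measure 2^-d, which is nonzero, so the curve meets it at
   some t >= 1. *)
apply: moment_measure_neq0; rewrite equi /= moment_measure_setT mul1e.
by apply/eqP; rewrite eqe invr_eq0 expf_neq0 // pnatr_eq0.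
Qed.
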